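(* Let $d\in\{2,3\}$, let $\mathcal{T}_h$ be a triangular ($d=2$) or tetrahedral ($d=3$) mesh of $\Omega\subset\mathbb{R}^d$, let $\lambda,\mu\in\mathbb{R}$ be constants with $\mu>0$ and $\lambda+\frac{2}{d}\mu>0$, and let the elasticity tensor be isotropic and homogeneous: $$c_{pqrs}=\lambda\delta_{pq}\delta_{rs}+\mu(\delta_{pr}\delta_{qs}+\delta_{ps}\delta_{qr}).$$ Let $P_i,P_j\in\mathcal{N}_h$ be two nodal points such that $j\in\Lambda_i$ (equivalently $i\in\Lambda_j$) and $\{P_i,P_j\}\not\subset\Gamma$. Then the spring constant $K_{ij}$ is positive-definite if and only if $$\max_{\xi\in\mathbb{R}^d,\ |\xi|=1}\left(\int_\Omega(\nabla\varphi_j\cdot\xi)(\nabla\varphi_i\cdot\xi)\,dx\right)<\frac{-\mu}{\lambda+\mu}\int_\Omega\nabla\varphi_j\cdot\nabla\varphi_i\,dx .$$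
   Context: $\Omega\subset\mathbb{R}^d$ is a bounded Lipschitz domain whose boundary $\Gamma=\partial\Omega$ is polygonal ($d=2$) or polyhedral ($d=3$). $\mathcal{T}_h=\{T^\alpha\}_{\alpha=1}^{N_e}$ is a (conforming) triangulation of $\Omega$ into closed triangles ($d=2$) or closed tetrahedra ($d=3$), and $\mathcal{N}_h=\{P_j\}_{j=1}^{N_p}$ is its set of nodal points (vertices). $P_1(\mathcal{T}_h)$ is the space of functions in $C^0(\overline\Omega)$ whose restriction to each $T^\alpha$ is linear (affine), and $\varphi_1,\dots,\varphi_{N_p}$ is its nodal basis, $\varphi_j(P_i)=\delta_{ij}$. $e_1,\dots,e_d$ is the standard basis of $\mathbb{R}^d$. A subscript $,p$ denotes $\partial/\partial x_p$. For $u\in H^1(\Omega)^d$, the strain is $e_{pq}[u]=\frac12(u_{p,q}+u_{q,p})$ and the stress is $\sigma_{pq}[u]=\sum_{r,s=1}^d c_{pqrs}e_{rs}[u]$; the bilinear form is $a(u,v)=\int_\Omega \sum_{p,q}\sigma_{pq}[u]\,e_{pq}[v]\,dx$. The spring constants are the matrices $K_{ij}=(K_{ij}^{kl})_{k,l=1,\dots,d}\in\mathbb{R}^{d\times d}$, $K_{ij}^{kl}:=-a(\varphi_j e_l,\varphi_i e_k)$, for $i,j\in\{1,\dots,N_p\}$, and $\Lambda_i:=\{j\in\{1,\dots,N_p\}\setminus\{i\}:\ K_{ij}\neq O\}$. A matrix $K\in\mathbb{R}^{d\times d}$ is positive-definite if $(K\xi)\cdot\xi>0$ for all $\xi\in\mathbb{R}^d\setminus\{0\}$.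 *)

(* Defs.v *)
From HB Require Import structures.
From mathcomp Require Import all_boot all_order all_algebra.
From mathcomp Require Import all_classical all_reals all_analysis.

Set Implicit Arguments.
Unset Strict Implicit.
Unset Printing Implicit Defensive.

Import Order.TTheory GRing.Theory Num.Theory.
Import numFieldNormedType.Exports.

Local Open Scope classical_set_scope.
Local Open Scope ring_scope.

(* MathComp-Analysis has no Lebesgue measure on 'rV[R]_n.  It is built here on
   the sigma-algebra generated by the coordinates (the Borel sets of R^n), as
   the n-fold product of the one-dimensional Lebesgue measure, each product
   being transported along R * 'rV[R]_n -> 'rV[R]_n.+1. *)

Definition row_measure_display : measure_display.
Proof. exact: default_measure_display. Qed.

Section measurable_row.
Context (R : realType) (n : nat).

Definition row_coord (i : 'I_n) (x : 'rV[R]_n) : measurableTypeR R := x 0 i.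

Let row_set0 : g_sigma_preimage row_coord set0.
Proof. exact: sigma_algebra0. Qed.

Let row_setC A :
  g_sigma_preimage row_coord A -> g_sigma_preimage row_coord (~` A).
Proof. exact: sigma_algebraC. Qed.

Let row_bigcup (F : _^nat) : (forall i, g_sigma_preimage row_coord (F i)) ->
  g_sigma_preimage row_coord (\bigcup_i (F i)).
Proof. exact: sigma_algebra_bigcup. Qed.

HB.instance Definition _ := @isMeasurable.Build row_measure_display
  'rV[R]_n (g_sigma_preimage row_coord) row_set0 row_setC row_bigcup.

End measurable_row.

Section row_cons.
Context (R : realType) (n : nat).

Definition row_cons (xy : measurableTypeR R * 'rV[R]_n) : 'rV[R]_n.+1 :=
  row_mx (const_mx xy.1 : 'M[R]_1) xy.2.

Definition row_uncons (v : 'rV[R]_n.+1) : measurableTypeR R * 'rV[R]_n :=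
  (v 0 0, \row_i v 0 (lift 0 i)).

Lemma row_consK : cancel row_cons row_uncons.
Proof.
move=> [x y]; congr (_, _).
  have e : 0 = lshift n (0 : 'I_1) :> 'I_n.+1 by exact/val_inj.
  by rewrite [LHS](congr1 (row_cons (x, y) 0) e) [LHS]row_mxEl mxE.
apply/rowP => i; rewrite mxE.
have e : lift 0 i = rshift 1 i :> 'I_n.+1 by exact/val_inj.
by rewrite [LHS](congr1 (row_cons (x, y) 0) e) [LHS]row_mxEr.
Qed.

Lemma measurable_row_fun d (T : measurableType d) m (f : T -> 'rV[R]_m) :
  (forall i, measurable_fun [set: T] (fun x => row_coord i (f x))) ->
  measurable_fun [set: T] f.
Proof.
move=> mf; suff : g_sigma_preimage (fun i x => row_coord i (f x)) `<=`
    measurable.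
  move=> sub _ A mA; rewrite setTI; apply: sub.
  have := @g_sigma_preimage_comp _ (measurableTypeR R) m 'rV[R]_m
    (@row_coord R m) T f.
  by rewrite /comp => ->; exists A => //; rewrite setTI.
apply: smallest_sub; first exact: sigma_algebra_measurable.
elim/big_ind : _ => [|A B sA sB|i _]; first exact: sub0set.
  by rewrite subUset; split.
by move=> A [B mB <-]; exact: mf.
Qed.

Lemma measurable_row_coord m (i : 'I_m) :
  measurable_fun [set: 'rV[R]_m] (@row_coord R m i).
Proof.
move=> _ A mA; rewrite setTI; apply: sub_sigma_algebra => /=.
by rewrite -bigcup_seq; exists i => /=; [rewrite mem_index_enum|
  exists A => //; rewrite setTI].
Qed.

Lemma measurable_row_cons : measurable_fun setT row_cons.
Proof.
apply: measurable_row_fun => i; rewrite /row_coord /row_cons.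
case: (splitP (i : 'I_(1 + n))) => [k ik|k ik].
  have -> : i = lshift n k :> 'I_n.+1 by exact/val_inj.
  rewrite (_ : (fun _ => _) = fst)//; apply/funext => x.
  by rewrite [LHS]row_mxEl mxE.
have -> : i = rshift 1 k :> 'I_n.+1 by exact/val_inj.
rewrite (_ : (fun _ => _) = row_coord k \o snd).
  exact: measurableT_comp (measurable_row_coord k) measurable_snd.
by apply/funext => x; rewrite [LHS]row_mxEr.
Qed.

Lemma measurable_row_uncons : measurable_fun setT row_uncons.
Proof.
apply/measurable_fun_pairP; split; first exact: (measurable_row_coord 0).
apply: measurable_row_fun => i; rewrite /row_coord /=.
by under eq_fun do rewrite mxE; exact: (measurable_row_coord (lift 0 i)).
Qed.

Context (mu : {sigma_finite_measure set 'rV[R]_n -> \bar R}).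

Definition lebesgue_row_step : set 'rV[R]_n.+1 -> \bar R :=
  pushforward (lebesgue_measure \x mu)%E row_cons.

HB.instance Definition _ := Measure.copy lebesgue_row_step
  (measure_function_pushforward__canonical__measure_function_Measure
    (lebesgue_measure \x mu)%E measurable_row_cons).

Let lebesgue_row_step_sigma_finite : sigma_finite setT lebesgue_row_step.
Proof.
have /sigma_finiteP[F [TF ndF Foo]] := sigma_finiteT (@lebesgue_measure R).
have /sigma_finiteP[G [TG ndG Goo]] := sigma_finiteT mu.
exists (fun k => row_uncons @^-1` (F k `*` G k)).
  rewrite -preimage_bigcup -[LHS](preimage_setT row_uncons); congr (_ @^-1` _).
  rewrite -setXTT TF TG predeqE => -[x y]; split.
    move=> [/= [k _ Fkx] [l _ Gly]]; exists (maxn k l) => //; split.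
    - by move: x Fkx; exact/subsetPset/ndF/leq_maxl.
    - by move: y Gly; exact/subsetPset/ndG/leq_maxr.
  by move=> [k _ []/= ? ?]; split; exists k.
move=> k; have [mF Fk] := Foo k; have [mG Gk] := Goo k; split.
  rewrite -[X in measurable X]setTI; apply: measurable_row_uncons => //.
  exact: measurableX.
rewrite /lebesgue_row_step /pushforward -comp_preimage.
rewrite (_ : row_uncons \o row_cons = id); last first.
  by apply/funext; exact: row_consK.
rewrite preimage_id product_measure1E//.
by rewrite lte_mul_pinfty// ge0_fin_numE.
Qed.

HB.instance Definition _ := Measure_isSigmaFinite.Build _ _ _
  lebesgue_row_step lebesgue_row_step_sigma_finite.

End row_cons.

Section lebesgue_row.
Context (R : realType).

Definition lebesgue_row0 : set 'rV[R]_0 -> \bar R := \d_(0 : 'rV[R]_0).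

HB.instance Definition _ := Measure.on lebesgue_row0.

Let lebesgue_row0_sigma_finite : sigma_finite setT lebesgue_row0.
Proof.
apply: fin_num_fun_sigma_finite; first by rewrite measure0.
by move=> A mA; rewrite /lebesgue_row0 /dirac.
Qed.

HB.instance Definition _ := Measure_isSigmaFinite.Build _ _ _
  lebesgue_row0 lebesgue_row0_sigma_finite.

Fixpoint lebesgue_row n : {sigma_finite_measure set 'rV[R]_n -> \bar R} :=
  match n with
  | 0 => lebesgue_row0
  | n'.+1 => lebesgue_row_step (lebesgue_row n')
  end.

End lebesgue_row.

Section geometry.
Context (R : realType) (d : nat).
Implicit Types (x y nu : 'rV[R]_d) (Omega : set 'rV[R]_d).

Definition dotv x y : R := \sum_p x 0 p * y 0 p.

(* The library norm `|x| on 'rV[R]_d is the sup norm. *)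
Definition enorm x : R := Num.sqrt (dotv x x).

Definition boundary Omega : set 'rV[R]_d := closure Omega `\` Omega°.

Definition convex_hull (I : finType) (V : {set I}) (P : I -> 'rV[R]_d) :
    set 'rV[R]_d :=
  [set x | exists w : I -> R, [/\ forall k, k \in V -> 0 <= w k,
    \sum_(k in V) w k = 1 & x = \sum_(k in V) w k *: P k]].

Definition affinely_independent (I : finType) (V : {set I})
    (P : I -> 'rV[R]_d) : Prop :=
  forall w : I -> R, \sum_(k in V) w k = 0 ->
    \sum_(k in V) w k *: P k = 0 -> forall k, k \in V -> w k = 0.

(* Near each boundary point, for some unit vector nu, Omega is the strict
   epigraph in direction nu of a Lipschitz function gamma of the orthogonal
   projection y - <y, nu> nu on the hyperplane normal to nu. *)
Definition lipschitz_boundary Omega : Prop :=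
  forall x, boundary Omega x ->
  exists (nu : 'rV[R]_d) (gamma : 'rV[R]_d -> R) (k r : R),
    [/\ enorm nu = 1, k.-lipschitz gamma, 0 < r
      & forall y, ball x r y ->
          (Omega y <-> gamma (y - dotv y nu *: nu) < dotv y nu)].

(* The boundary is a finite union of nondegenerate (d-1)-simplices: segments
   if d = 2, triangles if d = 3. *)
Definition polyhedral_boundary Omega : Prop :=
  exists (m : nat) (F : 'I_m -> 'I_d -> 'rV[R]_d),
    (forall a, affinely_independent [set: 'I_d]%SET (F a)) /\
    boundary Omega = \bigcup_a convex_hull [set: 'I_d]%SET (F a).

Definition polyhedral_lipschitz_domain Omega : Prop :=
  [/\ Omega !=set0, open Omega & connected Omega] /\
  [/\ bounded_set Omega, lipschitz_boundary Omega & polyhedral_boundary Omega].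

End geometry.

(* A mesh is given by its vertices P and, for each element, the set T alpha of
   indices of its d+1 vertices; the closed simplex itself is
   convex_hull (T alpha) P. *)
Section mesh.
Context (R : realType) (d Np Ne : nat) (Omega : set 'rV[R]_d).
Context (P : 'I_Np -> 'rV[R]_d) (T : 'I_Ne -> {set 'I_Np}).

Record triangulation : Prop := Triangulation {
  nodes_inj : injective P ;
  elements_inj : injective T ;
  element_card : forall alpha, #|T alpha| = d.+1 ;
  element_nondegenerate : forall alpha, affinely_independent (T alpha) P ;
  elements_conforming : forall alpha beta,
    convex_hull (T alpha) P `&` convex_hull (T beta) P =
    convex_hull (T alpha :&: T beta)%SET P ;
  elements_cover : \bigcup_alpha convex_hull (T alpha) P = closure Omega ;
  nodes_in_elements : forall j, exists alpha, j \in T alpha }.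

(* Functions on closure Omega are represented by functions on the whole space,
   whose values outside closure Omega are irrelevant. *)
Definition P1 : set ('rV[R]_d -> R) :=
  [set u | {within closure Omega, continuous u} /\
    forall alpha, exists (g : 'rV[R]_d) (b : R),
      forall x, convex_hull (T alpha) P x -> u x = dotv g x + b].

Definition nodal_basis (phi : 'I_Np -> 'rV[R]_d -> R) : Prop :=
  (forall j, P1 (phi j)) /\ forall i j, phi j (P i) = (j == i)%:R.

End mesh.

Section elasticity.
Context (R : realType) (d : nat) (Omega : set 'rV[R]_d).
Implicit Types (f : 'rV[R]_d -> R) (u v : 'rV[R]_d -> 'rV[R]_d).
Implicit Types (p q : 'I_d).

Definition basis_vector p : 'rV[R]_d := delta_mx 0 p.

(* Pointwise partial derivative.  A function of P1 is affine on each simplex,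
   so it exists off the (Lebesgue-null) union of the faces, and it represents
   there the weak derivative. *)
Definition partial p f : 'rV[R]_d -> R := 'D_(basis_vector p) f.

Definition grad f (x : 'rV[R]_d) : 'rV[R]_d := \row_p partial p f x.

Definition strain p q u (x : 'rV[R]_d) : R :=
  (partial q (fun y => u y 0 p) x + partial p (fun y => u y 0 q) x) / 2.

Context (c : 'I_d -> 'I_d -> 'I_d -> 'I_d -> R).

Definition stress p q u (x : 'rV[R]_d) : R :=
  \sum_r \sum_s c p q r s * strain r s u x.

Definition energy_form u v : R :=
  \int[lebesgue_row R d]_(x in Omega)
    (\sum_p \sum_q stress p q u x * strain p q v x).

Context (Np : nat) (phi : 'I_Np -> 'rV[R]_d -> R).

Definition spring_constant (i j : 'I_Np) : 'M[R]_d :=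
  \matrix_(k, l) - energy_form (fun x => phi j x *: basis_vector l)
                               (fun x => phi i x *: basis_vector k).

Definition neighbours (i : 'I_Np) : {set 'I_Np} :=
  [set j | (j != i) && (spring_constant i j != 0)]%SET.

End elasticity.

Definition isotropic (R : realType) (d : nat) (lambda mu : R)
    (p q r s : 'I_d) : R :=
  lambda * (p == q)%:R * (r == s)%:R
  + mu * ((p == r)%:R * (q == s)%:R + (p == s)%:R * (q == r)%:R).

(* With row vectors, K xi is xi *m K^T. *)
Definition positive_definite (R : realType) (d : nat) (K : 'M[R]_d) : Prop :=
  forall xi : 'rV[R]_d, xi != 0 -> 0 < dotv (xi *m K^T) xi.

Definition is_max (R : realType) (A : set R) (M : R) : Prop :=
  A M /\ ubound A M.

(* Main.v *)
Require Import Defs.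
From mathcomp Require Import all_boot all_order all_algebra.
From mathcomp Require Import all_classical all_reals all_analysis.
From mathcomp Require Import measurable_realfun ring lra.

Set Implicit Arguments.
Unset Strict Implicit.
Unset Printing Implicit Defensive.

Import Order.TTheory GRing.Theory Num.Theory.
Import numFieldNormedType.Exports.

Local Open Scope classical_set_scope.
Local Open Scope ring_scope.

(* Writing G_pq for the integral of d_p phi_j * d_q phi_i over Omega, the
   isotropic tensor contracts to
     (K_ij xi).xi = - ((lambda + mu) xi^T G xi + mu (tr G) |xi|^2),
   and lambda + mu > (1 - 2/d) mu >= 0; so, xi^T G xi being homogeneous,
   positivity for all xi <> 0 is the stated bound on its maximum over the
   compact unit sphere.
   The formula needs the products of partial derivatives to be integrable,
   including on the faces of the mesh, where the two-sided derivative may fail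
   to exist.  Along every ray issuing from a point of Omega, a P1 function is
   affine near that point, because finitely many convex elements cover the ray.
   The one-sided slopes therefore exist everywhere, take finitely many values
   and are pointwise limits of measurable difference quotients; the partial
   derivative is the common slope where the two slopes agree and the default
   value of lim elsewhere, hence measurable and bounded. *)

(** * Borel sets of R^n and finiteness of the Lebesgue measure on bounded sets *)

Lemma row_box_measurable (R : realType) n
    (A : 'I_n -> set (measurableTypeR R)) :
  (forall i, measurable (A i)) ->
  measurable [set x : 'rV[R]_n | forall i, A i (x 0 i)].
Proof.
move=> mA.
rewrite (_ : [set x | _] = \bigcap_(i in [set: 'I_n]) (row_coord i @^-1` A i)).
  apply: fin_bigcap_measurable => // i _.
  by rewrite -[X in measurable X]setTI; exact: measurable_row_coord.
by apply/seteqP; split=> x /= Ax i => [_|]; exact: Ax.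
Qed.

(** Balls are those of the sup norm, hence products of open intervals. *)
Lemma row_ball_measurable (R : realType) n (c : 'rV[R]_n) (r : R) :
  measurable (ball c r).
Proof.
have [r0|r0] := ltP 0 r; last first.
  rewrite (_ : ball c r = set0)//.
  by apply/seteqP; split=> // x [+ _]; rewrite ltNge r0.
pose A i := `]c 0 i - r, c 0 i + r[%classic.
rewrite (_ : ball c r = [set x | forall i, A i (x 0 i)]).
  by apply: row_box_measurable => i; exact: measurable_itv.
apply/seteqP; split=> x cx.
  by move=> i; have [_ /(_ 0 i)] := cx; rewrite ball_itv.
by split=> // k i; rewrite (ord1 k) ball_itv; exact: cx.
Qed.

(** The sigma-algebra is generated by the coordinates, not by the topology; the link is that [U] is
    the union of the countably many rational balls it contains. *)
Lemma row_open_measurable (R : realType) n (U : set 'rV[R]_n) :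
  open U -> measurable U.
Proof.
move=> oU.
pose B (qr : 'rV[rat]_n * rat) : set 'rV[R]_n :=
  ball (map_mx (@ratr R) qr.1) (ratr qr.2).
have -> : U = \bigcup_qr (if `[< B qr `<=` U >] then B qr else set0).
  apply/seteqP; split=> [x Ux|x [qr _]]; last first.
    by case: asboolP => // + Bx; exact.
  have /nbhs_ballP[e /= e0 xeU] : nbhs x U by apply: open_nbhs_nbhs; split.
  (* A rational ball of radius below [e / 2] that contains [x] stays inside [ball x e]. *)
  have e20 : e / 2 > 0 by rewrite divr_gt0.
  have [r /andP[r0 re]] : exists r : rat, (0 < ratr r :> R) && (ratr r < e / 2).
    by have [r] := rat_in_itvoo e20; rewrite in_itv/= => ?; exists r.
  have /choice[q qx] : forall i, exists q : rat, ball (x 0 i) (ratr r) (ratr q).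
    move=> i; have ltx : x 0 i - ratr r < x 0 i + ratr r.
      by rewrite ltrBlDr -addrA ltrDl addr_gt0.
    by have [q] := rat_in_itvoo ltx; exists q; rewrite ball_itv.
  have Bx : B (\row_i q i, r) x.
    by split=> // k i; rewrite !mxE (ord1 k); exact/ball_sym/qx.
  exists (\row_i q i, r) => //; rewrite asboolT// => y By.
  apply: xeU; rewrite (splitr e).
  apply: (@ball_triangle _ _ (map_mx (@ratr R) (\row_i q i))).
    exact/ball_sym/(le_ball (ltW re)).
  exact: (le_ball (ltW re)).
apply: countable_bigcupT_measurable => // qr.
by case: ifP => // _; exact: row_ball_measurable.
Qed.

Lemma row_open_continuous_measurable (R : realType) n (D : set 'rV[R]_n)
    (f : 'rV[R]_n -> R) :
  open D -> (forall x, D x -> {for x, continuous f}) ->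
  measurable_fun D (f : _ -> measurableTypeR R).
Proof.
move=> oD cf _; apply: (measurability _ (RGenOpens.measurableE R));
  last exact: row_open_measurable.
move=> _ [_ [a [b ->] <-]]; apply: row_open_measurable.
rewrite openE => x [Dx fx]; apply: filterI; first exact: open_nbhs_nbhs.
by apply: cf => //; apply: open_nbhs_nbhs; split => //; exact: interval_open.
Qed.

Lemma row_cons0 (R : realType) n (xy : measurableTypeR R * 'rV[R]_n) :
  row_cons xy 0 0 = xy.1.
Proof. by have /(congr1 fst) := row_consK xy. Qed.

Lemma row_consS (R : realType) n (xy : measurableTypeR R * 'rV[R]_n) i :
  row_cons xy 0 (lift 0 i) = xy.2 0 i.
Proof. by have /(congr1 snd)/rowP/(_ i) := row_consK xy; rewrite mxE. Qed.

(** By induction on the dimension: pulled back along [row_cons], a cube is an interval times a cube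
    of one dimension less. *)
Lemma lebesgue_row_box (R : realType) n (M : R) :
  (lebesgue_row R n
     [set x : 'rV[R]_n | forall i, `[- M, M]%classic (x 0 i)]%R < +oo)%E.
Proof.
elim: n => [|n IHn].
  rewrite /= /lebesgue_row0 /dirac/= indicE.
  by case: (_ \in _); rewrite ltry.
rewrite /= /lebesgue_row_step /pushforward.
set A := [set x : 'rV_n | forall i, `[- M, M]%classic (x 0 i)].
rewrite (_ : _ @^-1` _ = `[- M, M]%classic `*` A); last first.
  apply/seteqP; split=> [xy H|xy [H0 HS] i].
    split=> [|i]; first by rewrite -row_cons0; exact: H.
    by rewrite -row_consS; exact: H.
  have [k ->|->] := unliftP 0 i; first by rewrite row_consS; exact: HS.
  by rewrite row_cons0.
have mA : measurable A.
  by apply: (@row_box_measurable _ _ (fun=> `[- M, M]%classic)) => i;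
    exact: measurable_itv.
rewrite product_measure1E//=.
rewrite lte_mul_pinfty// lebesgue_measure_itv/=.
by case: ifP.
Qed.

Lemma row_coord_le_norm (R : realType) n (x : 'rV[R]_n) i : `|x 0 i| <= `|x|.
Proof.
rewrite [leRHS]/Num.Def.normr /= mx_normrE.
exact: (le_bigmax _ (fun ij => `|x ij.1 ij.2|) (0, i)).
Qed.

Lemma lebesgue_row_bounded (R : realType) n (A : set 'rV[R]_n) :
  bounded_set A -> measurable A -> (lebesgue_row R n A < +oo)%E.
Proof.
move=> [M [_ AM]] mA; apply: le_lt_trans (lebesgue_row_box n (M + 1)).
apply: le_measure; rewrite ?inE//.
  by apply: (@row_box_measurable _ _ (fun=> `[- (M + 1), M + 1]%classic)) => i;
    exact: measurable_itv.
(* [bounded_set] gives a bound only for each number strictly above [M], hence the half-width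
   [M + 1]. *)
have M1 : M < M + 1 by rewrite ltrDl.
move=> x Ax i; have := AM _ M1 x Ax.
by rewrite /= in_itv/= -ler_norml; exact/le_trans/row_coord_le_norm.
Qed.

(** * Algebra of the Euclidean inner product *)

Section dotv_theory.
Context (R : realType) (d : nat).
Implicit Types x y z : 'rV[R]_d.

Lemma dotvC x y : dotv x y = dotv y x.
Proof. by apply: eq_bigr => p _; rewrite mulrC. Qed.

Lemma dotvDr x y z : dotv x (y + z) = dotv x y + dotv x z.
Proof.
by rewrite /dotv -big_split; apply: eq_bigr => p _; rewrite mxE mulrDr.
Qed.

Lemma dotvZr x (a : R) y : dotv x (a *: y) = a * dotv x y.
Proof.
by rewrite /dotv mulr_sumr; apply: eq_bigr => p _; rewrite mxE mulrCA.
Qed.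

Lemma dotvZl (a : R) x y : dotv (a *: x) y = a * dotv x y.
Proof. by rewrite dotvC dotvZr dotvC. Qed.

Lemma dotvv_ge0 x : 0 <= dotv x x.
Proof. by apply: sumr_ge0 => p _; exact: sqr_ge0. Qed.

Lemma dotvv_eq0 x : (dotv x x == 0) = (x == 0).
Proof.
apply/eqP/eqP => [/psumr_eq0P x0|->]; last first.
  by apply: big1 => p _; rewrite mxE mul0r.
apply/rowP => p; rewrite mxE; apply/eqP.
by rewrite -sqrf_eq0 expr2 x0// => q _; exact: sqr_ge0.
Qed.

Lemma enorm_eq1 x : enorm x = 1 <-> dotv x x = 1.
Proof.
split=> [x1|]; last by rewrite /enorm => ->; rewrite sqrtr1.
by rewrite -[LHS]sqr_sqrtr ?dotvv_ge0// -/(enorm x) x1 expr1n.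
Qed.

End dotv_theory.

(** * One-sided slopes along rays *)

Lemma harmonic_at_right (R : realType) : @harmonic R @ \oo --> (0 : R)^'+.
Proof.
move=> A [e /= e0 eA]; have := near_infty_natSinv_lt (PosNum e0).
apply: filterS => n /= ne; apply: eA; last by rewrite /= invr_gt0.
by rewrite /ball_/= sub0r normrN ger0_norm.
Qed.

Lemma near_right_left_dnbhs (R : realFieldType) (p : R) (P : set R) :
  (\forall h \near p^'+, P h) -> (\forall h \near p^'-, P h) ->
  \forall h \near p^', P h.
Proof.
rewrite !near_withinE => rP lP; apply: filterS2 rP lP => h rh lh.
by rewrite neq_lt => /orP[].
Qed.

Section rays.
Context (R : realType) (d : nat).
Implicit Types (f s : 'rV[R]_d -> R) (Omega : set 'rV[R]_d).

(** An exact equality on an initial segment of the ray rather than a limit, so that difference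
    quotients become eventually constant. *)
Definition ray_slope f (x w : 'rV[R]_d) (a : R) :=
  \forall h \near 0^'+, f (x + h *: w) = f x + h * a.

Lemma cvg_ray (x w : 'rV[R]_d) : (x + h *: w) @[h --> (0 : R)^'+] --> x.
Proof.
apply: cvg_at_right_filter; rewrite -[X in _ --> X]addr0 -(scale0r w).
by apply: cvgD; [exact: cvg_cst|exact: scalel_continuous].
Qed.

(** Near 0 the difference quotient is constantly [a] on the right and [- b] on the left. *)
Lemma derive_ray_slope f (x v : 'rV[R]_d) (a b : R) :
  ray_slope f x v a -> ray_slope f x (- v) b ->
  'D_v f x = if a == - b then a else point.
Proof.
move=> fa fb; pose q h := h^-1 *: ((f \o shift x) (h *: v) - f x).
have qa : \forall h \near 0^'+, q h = a.
  near=> h; rewrite /q /= (addrC (h *: v)).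
  have -> : f (x + h *: v) = f x + h * a by near: h; exact: fa.
  rewrite addrAC subrr add0r; apply: mulKf; apply: lt0r_neq0.
  by near: h; exact: nbhs_right_gt.
have qb : \forall h \near 0^'-, q h = - b.
  suff : \forall h \near 0^'+, q (- h) = - b by rewrite -{2}oppr0 at_leftN.
  near=> h; rewrite /q /= (addrC (- h *: v)) scaleNr -scalerN.
  have -> : f (x + h *: - v) = f x + h * b by near: h; exact: fb.
  by rewrite addrAC subrr add0r /GRing.scale/= invrN mulNr mulKf.
have [ab|/eqP ab] := eqVneq a (- b).
  rewrite -ab in qb.
  apply: cvg_lim => //; apply: cvg_near_cst.
  exact: near_right_left_dnbhs.
(* The one-sided limits differ, so the quotient diverges and the derivative takes the default value
   [point] of [lim]. *)
apply: dvgP => /cvg_ex[l ql]; apply: ab; transitivity l.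
  apply: (@cvg_unique _ _ (q @ 0^'+)) => //=; first exact: cvg_near_cst.
  exact: cvg_dnbhs_at_right.
apply: (@cvg_unique _ _ (q @ 0^'-)) => //=; last exact: cvg_near_cst.
exact: cvg_dnbhs_at_left.
Unshelve. all: by end_near. Qed.

Lemma ray_slope_measurable Omega f s (w : 'rV[R]_d) :
  open Omega -> (forall x, Omega x -> {for x, continuous f}) ->
  (forall x, Omega x -> ray_slope f x w (s x)) ->
  measurable_fun Omega (s : _ -> measurableTypeR R).
Proof.
move=> oO cf fs.
(* Continuity of [f] is known only on [Omega], so the quotient [q n] is used only where the shifted
   point is still in [Omega]. *)
pose A n : set 'rV[R]_d := [set x | Omega (x + n.+1%:R^-1 *: w)].
pose q n (x : 'rV[R]_d) : R := n.+1%:R * (f (x + n.+1%:R^-1 *: w) - f x).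
have cshift (u : 'rV[R]_d) : continuous (fun x : 'rV[R]_d => x + u).
  move=> x; apply: (@continuousD _ _ _ id (cst u)) => //.
  exact: cst_continuous.
have oA n : open (A n).
  by apply: (open_comp _ oO) => x _; exact: cshift.
apply: (@measurable_fun_cvg _ _ _ _ (fun n => q n \_ (A n))) => [n|x Ox].
  apply/measurable_restrict; do ?exact: row_open_measurable.
  apply: row_open_continuous_measurable; first exact: openI.
  move=> x [Ox Ax]; apply: continuousM; first exact: cst_continuous.
  apply: continuousB; last exact: cf.
  by apply: (@continuous_comp _ _ _ (fun x : 'rV[R]_d => x + _) f);
    [exact: cshift|exact: cf].
(* At a fixed [x] the quotients along the steps 1/(n+1) are eventually equal to [s x]. *)
apply: cvg_near_cst.
have Oray : \forall h \near 0^'+, Omega (x + h *: w).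
  by apply: cvg_ray; apply: open_nbhs_nbhs.
near=> n; have [On fn] : (Omega (x + n.+1%:R^-1 *: w) /\
    f (x + n.+1%:R^-1 *: w) = f x + n.+1%:R^-1 * s x).
  by near: n; exact: (harmonic_at_right (filterI Oray (fs x Ox))).
rewrite patchE ifT; last by rewrite inE.
by rewrite /q fn addrAC subrr add0r mulrA divff// mul1r.
Unshelve. all: by end_near. Qed.

(** A convex piece that meets the ray arbitrarily close to [x] contains an initial segment of it,
    without [x] itself; since finitely many pieces cover the ray near [x], one of them does so. *)
Lemma piecewise_affine_ray_slope Omega (I : finType) (S : I -> set 'rV[R]_d)
    (g : I -> 'rV[R]_d) (b : I -> R) f (x w : 'rV[R]_d) :
  open Omega -> Omega `<=` \bigcup_i S i ->
  (forall i y z (t : R), S i y -> S i z -> 0 <= t <= 1 ->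
     S i ((1 - t) *: y + t *: z)) ->
  (forall i y, S i y -> f y = dotv (g i) y + b i) ->
  Omega x -> {for x, continuous f} ->
  exists i, ray_slope f x w (dotv (g i) w).
Proof.
move=> oO OS cS fS Ox cf.
have fdotv i h : dotv (g i) (x + h *: w) + b i =
    dotv (g i) x + b i + h * dotv (g i) w.
  by rewrite dotvDr dotvZr addrAC.
suff [i Si] : exists i, \forall h \near 0^'+, S i (x + h *: w).
  (* The point [x] is not known to lie in [S i]; the affine formula reaches it by continuity of [f]
     along the ray. *)
  exists i; suff fx : f x = dotv (g i) x + b i.
    by apply: filterS Si => h /fS ->; rewrite fx fdotv.
  apply: (@cvg_unique _ (@norm_hausdorff _ _)
    ((f \o (fun h => x + h *: w)) @ 0^'+)).
    by apply: (@cvg_comp _ _ _ (fun h => x + h *: w) f _ (nbhs x)) cf;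
      exact: cvg_ray.
  apply: (@cvg_trans _
    ((fun h => dotv (g i) x + b i + h * dotv (g i) w) @ 0^'+)).
    by apply: near_eq_cvg; apply: filterS Si => h /fS /= ->.
  apply: cvg_at_right_filter.
  rewrite -[X in _ --> X]addr0 -[X in _ --> _ + X](mul0r (dotv (g i) w)).
  apply: cvgD; first exact: cvg_cst.
  by apply: cvgM; [exact: cvg_id|exact: cvg_cst].
apply: contrapT => /forallNP nS.
have nSi i : \forall h \near 0^'+, ~ S i (x + h *: w).
  have [e e0 eS] : exists2 e : R, 0 < e &
      forall h, 0 < h < e -> ~ S i (x + h *: w).
    apply: contrapT => nearS; apply: (nS i).
    have rec e : 0 < e -> exists2 h, 0 < h < e & S i (x + h *: w).
      move=> e0; apply: contrapT => he; apply: nearS; exists e => // h h0e Sih.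
      by apply: he; exists h.
    (* Fix one hit [h1]; every smaller [h] has another hit [h2] below it, and convexity puts the
       point at [h] in [S i]. This contradicts [nS]. *)
    have [h1 /andP[h10 _] Sh1] := rec 1 ltr01.
    near=> h; have h0 : 0 < h by near: h; exact: nbhs_right_gt.
    have hh1 : h < h1 by near: h; exact: nbhs_right_lt.
    have [h2 /andP[h20 h2h] Sh2] := rec h h0.
    have d0 : 0 < h1 - h2 by rewrite subr_gt0 (lt_trans h2h).
    pose t := (h - h2) / (h1 - h2).
    have -> : x + h *: w = (1 - t) *: (x + h2 *: w) + t *: (x + h1 *: w).
      rewrite !scalerDr addrACA -scalerDl subrK scale1r !scalerA -scalerDl.
      congr (_ + _ *: _); rewrite /t; field.
      exact: lt0r_neq0.
    apply: cS => //; rewrite divr_ge0 ?ler_pdivrMr ?mul1r ?subr_ge0 ?ltW//=.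
      by rewrite ltrD2r.
    by rewrite (lt_trans h2h).
  near=> h; apply: eS; apply/andP; split; near: h.
    exact: nbhs_right_gt.
  exact: nbhs_right_lt.
have Oray : \forall h \near 0^'+, Omega (x + h *: w).
  by apply: cvg_ray; apply: open_nbhs_nbhs.
have Sall : \forall h \near 0^'+, forall i, ~ S i (x + h *: w).
  exact: filter_forall.
have [h [/OS[i _ Si] /(_ i)]] := filter_ex (filterI Oray Sall); exact.
Unshelve. all: by end_near. Qed.

End rays.

Lemma convex_hull_conv (R : realType) d (I : finType) (V : {set I})
    (P : I -> 'rV[R]_d) (y z : 'rV[R]_d) (t : R) :
  convex_hull V P y -> convex_hull V P z -> 0 <= t <= 1 ->
  convex_hull V P ((1 - t) *: y + t *: z).
Proof.
move=> [u [u0 u1 ->]] [v [v0 v1 ->]] /andP[t0 t1].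
exists (fun k => (1 - t) * u k + t * v k); split=> [k kV||].
- by apply: addr_ge0; apply: mulr_ge0; rewrite ?subr_ge0 ?u0 ?v0.
- by rewrite big_split/= -!mulr_sumr u1 v1 !mulr1 subrK.
- rewrite !scaler_sumr -big_split /=; apply: eq_bigr => k _ /=.
  by rewrite [RHS]scalerDl !scalerA.
Qed.

(** * Measurability, boundedness and integrability of partial derivatives of P1 functions *)

Section P1_partial.
Context (R : realType) (d Np Ne : nat) (Omega : set 'rV[R]_d).
Context (P : 'I_Np -> 'rV[R]_d) (T : 'I_Ne -> {set 'I_Np}).
Hypotheses (oO : open Omega) (bO : bounded_set Omega).
Hypothesis (hT : triangulation Omega P T).

Lemma P1_continuous f x : P1 Omega P T f -> Omega x -> {for x, continuous f}.
Proof.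
move=> [cf _] Ox.
have := continuous_subspaceW (@subset_closure _ Omega) cf.
by rewrite continuous_open_subspace//; apply; rewrite inE.
Qed.

Lemma P1_ray_slope f w : P1 Omega P T f ->
  exists (s : 'rV[R]_d -> R) (C : R), forall x, Omega x ->
    ray_slope f x w (s x) /\ `|s x| <= C.
Proof.
move=> hf; have [_ /choice[g /choice[b fgb]]] := hf.
(* The slope is one of the finitely many numbers [dotv (g i) w], so the sum of their absolute values
   bounds it uniformly in [x]. *)
have /choice[s sP] : forall x, exists a, Omega x ->
    ray_slope f x w a /\ `|a| <= \sum_i `|dotv (g i) w|.
  move=> x; have [Ox|nOx] := pselect (Omega x); last by exists 0.
  have [i fi] : exists i, ray_slope f x w (dotv (g i) w).
    apply: (@piecewise_affine_ray_slope _ _ Omega _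
      (fun i => convex_hull (T i) P) g b) => //.
    - by rewrite (elements_cover hT); exact: subset_closure.
    - by move=> i y z t; exact: convex_hull_conv.
    - exact: P1_continuous.
  exists (dotv (g i) w) => _; split=> //.
  by rewrite (bigD1 i)//= lerDl sumr_ge0.
by exists s, (\sum_i `|dotv (g i) w|).
Qed.

Lemma P1_partial f p : P1 Omega P T f ->
  measurable_fun Omega (partial p f : _ -> measurableTypeR R) /\
  exists C : R, forall x, Omega x -> `|partial p f x| <= C.
Proof.
move=> hf; have mO := row_open_measurable oO.
have [s [C sP]] := P1_ray_slope (basis_vector R p) hf.
have [t [D tP]] := P1_ray_slope (- basis_vector R p) hf.
have partialE : {in Omega, (fun x => if s x == - t x then s x else point) =1
    partial p f}.
  move=> x; rewrite inE => Ox; rewrite /partial.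
  by rewrite (derive_ray_slope (sP x Ox).1 (tP x Ox).1).
have ms : measurable_fun Omega (s : _ -> measurableTypeR R).
  apply: (ray_slope_measurable oO) => x Ox; first exact: P1_continuous hf Ox.
  exact: (sP x Ox).1.
have mt : measurable_fun Omega (t : _ -> measurableTypeR R).
  apply: (ray_slope_measurable oO) => x Ox; first exact: P1_continuous hf Ox.
  exact: (tP x Ox).1.
split.
  apply: eq_measurable_fun partialE _; apply: measurable_fun_if => //.
    by apply: measurable_fun_eqr => //; exact: measurableT_comp.
  by apply: measurable_funS ms.
(* The bound must also cover the default value taken where the two slopes disagree. *)
exists (Num.max C `|point : R|) => x Ox; rewrite -partialE ?inE//.
by case: ifP => _; rewrite le_max ?(sP x Ox).2 ?lexx ?orbT.
Qed.

Lemma P1_partialM_integrable f1 f2 p q :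
  P1 Omega P T f1 -> P1 Omega P T f2 ->
  (lebesgue_row R d).-integrable Omega
    (EFin \o (fun x => partial p f1 x * partial q f2 x)).
Proof.
move=> /P1_partial - /(_ p)[m1 [C1 b1]] /P1_partial - /(_ q)[m2 [C2 b2]].
have mO := row_open_measurable oO.
apply: measurable_bounded_integrable => //.
- exact: lebesgue_row_bounded.
- exact: measurable_funM.
exists (C1 * C2); split=> [|M CM x Ox]; first exact: num_real.
by apply: le_trans (ltW CM); rewrite /= normrM ler_pM ?b1 ?b2.
Qed.

End P1_partial.

(** * Isotropic energy and spring constants in terms of integrals of gradient products *)

Lemma Rintegral_sum d (X : measurableType d) (R : realType)
    (m : {measure set X -> \bar R}) (D : set X) (I : Type) (r : seq I)
    (F : I -> X -> R) :
  measurable D -> (forall k, m.-integrable D (EFin \o F k)) ->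
  \int[m]_(x in D) (\sum_(k <- r) F k x) =
  \sum_(k <- r) \int[m]_(x in D) F k x.
Proof.
move=> mD iF; elim: r => [|k r IHr].
  under eq_Rintegral do rewrite big_nil.
  by rewrite Rintegral_cst// mul0r big_nil.
under eq_Rintegral do rewrite big_cons.
rewrite RintegralD//; first by rewrite IHr big_cons.
rewrite (_ : EFin \o _ = fun x => (\sum_(k <- r) (EFin \o F k) x)%E).
  by apply: integrable_sum => // l _; exact: iF.
by apply/funext => x /=; rewrite sumEFin.
Qed.

Section elastic_energy.
Context (R : realType) (d : nat).
Implicit Types (a b : 'rV[R]_d) (k l p q : 'I_d).

Lemma sum_delta (F : 'I_d -> R) k : \sum_p (p == k)%:R * F p = F k.
Proof.
rewrite (bigD1 k)//= eqxx mul1r big1 ?addr0// => p /negPf ->.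
by rewrite mul0r.
Qed.

(** Hooke's law: stress = lambda (tr e) I + 2 mu e. Symmetry of [e] merges the two mu terms. *)
Lemma isotropic_stress (lambda mu : R) (e : 'I_d -> 'I_d -> R) p q :
  (forall r s, e r s = e s r) ->
  \sum_r \sum_s isotropic lambda mu p q r s * e r s =
  lambda * (p == q)%:R * (\sum_r e r r) + 2 * mu * e p q.
Proof.
move=> eC.
transitivity (\sum_r \sum_s (s == r)%:R * (lambda * (p == q)%:R * e r s) +
    mu * (\sum_r \sum_s (s == q)%:R * ((r == p)%:R * e r s) +
          \sum_r \sum_s (s == p)%:R * ((r == q)%:R * e r s))).
  rewrite -big_split mulr_sumr -big_split /=; apply: eq_bigr => r _.
  rewrite -big_split mulr_sumr -big_split /=; apply: eq_bigr => s _.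
  rewrite /isotropic [r == s]eq_sym [p == r]eq_sym [q == s]eq_sym.
  by rewrite [p == s]eq_sym [q == r]eq_sym; ring.
under eq_bigr do rewrite sum_delta.
under [X in mu * (X + _)]eq_bigr do rewrite sum_delta.
under [X in mu * (_ + X)]eq_bigr do rewrite sum_delta.
by rewrite -mulr_sumr !sum_delta (eC q p); ring.
Qed.

(** The strain of f e_l at a point where f has gradient [a], which makes the energy density a purely
    algebraic expression. *)
Definition strain_of_gradient l a p q : R :=
  (a 0 q * (p == l)%:R + a 0 p * (q == l)%:R) / 2.

(** By Hooke's law the density is lambda (tr e)(tr e') + 2 mu (e : e'). Here tr e = a_l, tr e' =
    b_k, and 2 (e : e') is the factor of mu on the right. *)
Lemma isotropic_energy_density (lambda mu : R) k l a b :
  \sum_p \sum_q (\sum_r \sum_s isotropic lambda mu p q r s *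
     strain_of_gradient l a r s) * strain_of_gradient k b p q =
  lambda * (a 0 l * b 0 k) + mu * ((k == l)%:R * dotv a b + a 0 k * b 0 l).
Proof.
set e := strain_of_gradient l a; set e' := strain_of_gradient k b.
have eC r s : e r s = e s r by rewrite /e /strain_of_gradient addrC.
have tre : \sum_r e r r = a 0 l.
  rewrite -[RHS](sum_delta (fun r => a 0 r)); apply: eq_bigr => r _.
  by rewrite /e /strain_of_gradient; field.
have tre' : \sum_r e' r r = b 0 k.
  rewrite -[RHS](sum_delta (fun r => b 0 r)); apply: eq_bigr => r _.
  by rewrite /e' /strain_of_gradient; field.
have ee' : \sum_p \sum_q e p q * e' p q =
    ((k == l)%:R * dotv a b + a 0 k * b 0 l) / 2.
  transitivity (\sum_q e k q * b 0 q).
    transitivity (\sum_p ((p == k)%:R * (\sum_q e p q * b 0 q) / 2) +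
                  \sum_p \sum_q ((q == k)%:R * (e p q * b 0 p / 2))).
      rewrite -big_split; apply: eq_bigr => p _ /=.
      rewrite mulr_sumr mulr_suml -big_split; apply: eq_bigr => q _ /=.
      by rewrite /e' /strain_of_gradient; field.
    rewrite -mulr_suml sum_delta.
    under [X in _ + X]eq_bigr do rewrite sum_delta.
    rewrite -mulr_suml [X in _ + X / 2](eq_bigr (fun q => e k q * b 0 q)).
      by field.
    by move=> q _; rewrite eC.
  transitivity ((k == l)%:R / 2 * (\sum_q a 0 q * b 0 q) +
      \sum_q (q == l)%:R * (a 0 k * b 0 q / 2)).
    rewrite mulr_sumr -big_split; apply: eq_bigr => q _ /=.
    by rewrite /e /strain_of_gradient; field.
  by rewrite sum_delta /dotv; field.
transitivity (\sum_p \sum_q (q == p)%:R * (lambda * a 0 l * e' p q) +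
              2 * mu * \sum_p \sum_q e p q * e' p q).
  rewrite mulr_sumr -big_split; apply: eq_bigr => p _ /=.
  rewrite mulr_sumr -big_split; apply: eq_bigr => q _ /=.
  by rewrite isotropic_stress// tre (eq_sym p); ring.
under eq_bigr do rewrite sum_delta.
by rewrite -mulr_sumr tre' ee'; field.
Qed.

(** For F p q = a_p b_q the right-hand side is the energy density above. Writing the density as a
    contraction linear in [F] lets the integral pass through it. *)
Lemma isotropic_contract (lambda mu : R) k l (F : 'I_d -> 'I_d -> R) :
  \sum_p \sum_q isotropic lambda mu l p k q * F p q =
  lambda * F l k + mu * ((k == l)%:R * (\sum_p F p p) + F k l).
Proof.
transitivity (\sum_p (p == l)%:R * (lambda * \sum_q (q == k)%:R * F p q) +
    mu * (\sum_p (k == l)%:R * (\sum_q (q == p)%:R * F p q) +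
          \sum_p (p == k)%:R * (\sum_q (q == l)%:R * F p q))).
  rewrite -big_split mulr_sumr -big_split /=; apply: eq_bigr => p _.
  rewrite !mulr_sumr -big_split mulr_sumr -big_split /=.
  apply: eq_bigr => q _; rewrite /isotropic (eq_sym l p) (eq_sym k q).
  by rewrite (eq_sym l k) (eq_sym p q) (eq_sym l q); ring.
rewrite !sum_delta [in RHS]mulr_sumr; congr (_ + _ * (_ + _)).
by apply: eq_bigr => p _; rewrite sum_delta.
Qed.

(** Valid even where [f] has no derivative: component [l] is [f] itself, default values included,
    and the others are constantly 0. *)
Lemma partial_basis_scale (f : 'rV[R]_d -> R) p q l x :
  partial q (fun y => (f y *: basis_vector R l) 0 p) x =
  partial q f x * (p == l)%:R.
Proof.
have [->|pl] := eqVneq p l.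
  rewrite mulr1 (_ : (fun y => _) = f)//; apply/funext => y.
  by rewrite !mxE !eqxx mulr1.
rewrite mulr0 /partial [X in 'D__ X _](_ : _ = cst 0) ?derive_cst//.
by apply/funext => y; rewrite !mxE (negPf pl) andbF mulr0.
Qed.

Lemma strain_basis_scale (f : 'rV[R]_d -> R) p q l x :
  strain p q (fun y => f y *: basis_vector R l) x =
  strain_of_gradient l (grad f x) p q.
Proof. by rewrite /strain !partial_basis_scale /strain_of_gradient !mxE. Qed.

Context (Omega : set 'rV[R]_d) (Np : nat) (phi : 'I_Np -> 'rV[R]_d -> R).
Context (i j : 'I_Np).
Hypothesis mO : measurable Omega.
Hypothesis iphi : forall p q, (lebesgue_row R d).-integrable Omega
  (EFin \o (fun x => partial p (phi j) x * partial q (phi i) x)).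

Let F p q x := partial p (phi j) x * partial q (phi i) x.

Let G p q : R := \int[lebesgue_row R d]_(x in Omega) F p q x.

Lemma Rintegral_gradM_sum (c : 'I_d -> 'I_d -> R) :
  \int[lebesgue_row R d]_(x in Omega) (\sum_p \sum_q c p q * F p q x) =
  \sum_p \sum_q c p q * G p q.
Proof.
under eq_Rintegral do rewrite pair_bigA.
rewrite pair_bigA Rintegral_sum// => [|pq].
  by apply: eq_bigr => pq _; rewrite RintegralZl//; exact: iphi.
rewrite (_ : EFin \o _ =
    fun x => (c pq.1 pq.2)%:E * (EFin \o F pq.1 pq.2) x)%E//.
by apply: integrableZl; [exact: mO|exact: iphi].
Qed.

Lemma Rintegral_gradM xi eta :
  \int[lebesgue_row R d]_(x in Omega)
    (dotv (grad (phi j) x) xi * dotv (grad (phi i) x) eta) =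
  \sum_p \sum_q xi 0 p * eta 0 q * G p q.
Proof.
rewrite -Rintegral_gradM_sum; apply: eq_Rintegral => x _.
rewrite /dotv mulr_suml; apply: eq_bigr => p _.
by rewrite mulr_sumr; apply: eq_bigr => q _; rewrite !mxE /F; ring.
Qed.

Lemma Rintegral_dot_grad :
  \int[lebesgue_row R d]_(x in Omega) dotv (grad (phi j) x) (grad (phi i) x) =
  \sum_p G p p.
Proof.
rewrite -Rintegral_sum//; last by move=> p; exact: iphi.
by apply: eq_Rintegral => x _; apply: eq_bigr => p _; rewrite !mxE.
Qed.

Lemma isotropic_spring_constant (lambda mu : R) k l :
  spring_constant Omega (isotropic lambda mu) phi i j k l =
  - (lambda * G l k + mu * ((k == l)%:R * (\sum_p G p p) + G k l)).
Proof.
rewrite mxE /energy_form -isotropic_contract -Rintegral_gradM_sum; congr (- _).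
apply: eq_Rintegral => x _.
transitivity (\sum_p \sum_q (\sum_r \sum_s isotropic lambda mu p q r s *
   strain_of_gradient l (grad (phi j) x) r s) *
   strain_of_gradient k (grad (phi i) x) p q).
  apply: eq_bigr => p _; apply: eq_bigr => q _.
  rewrite strain_basis_scale; congr (_ * _).
  by apply: eq_bigr => r _; apply: eq_bigr => s _; rewrite strain_basis_scale.
rewrite isotropic_energy_density isotropic_contract !mxE.
congr (_ + _ * (_ + _)).
by congr (_ * _); apply: eq_bigr => p _; rewrite !mxE.
Qed.

(** The matrix [G] and its transpose have the same quadratic form, so the lambda and mu
    contributions combine into the coefficient lambda + mu. *)
Lemma isotropic_spring_form (lambda mu : R) xi :
  dotv (xi *m (spring_constant Omega (isotropic lambda mu) phi i j)^T) xi =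
  - ((lambda + mu) * (\int[lebesgue_row R d]_(x in Omega)
        (dotv (grad (phi j) x) xi * dotv (grad (phi i) x) xi)) +
     mu * (\int[lebesgue_row R d]_(x in Omega)
        dotv (grad (phi j) x) (grad (phi i) x)) * dotv xi xi).
Proof.
rewrite Rintegral_gradM Rintegral_dot_grad.
set q := \sum_p \sum_q _; set t := \sum_p _.
transitivity (- (lambda * (\sum_k \sum_l xi 0 l * xi 0 k * G l k) +
    mu * (t * (\sum_k \sum_l (l == k)%:R * (xi 0 k * xi 0 l)) + q))).
  rewrite /q !mulr_sumr -big_split mulr_sumr -big_split -sumrN.
  apply: eq_bigr => k _ /=; rewrite mxE mulr_suml.
  rewrite !mulr_sumr -big_split mulr_sumr -big_split -sumrN.
  apply: eq_bigr => l _ /=.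
  rewrite [_^T _ _]mxE isotropic_spring_constant -/t (eq_sym k l).
  (* ring does not terminate while the integrals are visible. *)
  by move: (G l k) (G k l) t => g1 g2 t0; ring.
under [X in t * X]eq_bigr do rewrite sum_delta.
by rewrite exchange_big -/q /dotv /=; ring.
Qed.

End elastic_energy.

(** * Maximum of a quadratic form on the Euclidean unit sphere *)

Lemma quadratic_continuous (R : realType) d (A : 'I_d -> 'I_d -> R) :
  continuous (fun x : 'rV[R]_d => \sum_p \sum_q x 0 p * x 0 q * A p q).
Proof.
apply: continuous_big; first exact: add_continuous.
move=> p _; apply: continuous_big; first exact: add_continuous.
move=> q _ x.
apply: (@continuousM _ _ (fun y : 'rV[R]_d => y 0 p * y 0 q) (cst (A p q)));
  last exact: cst_continuous.
by apply: continuousM; exact: coord_continuous.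
Qed.

(** Presents the squared norm as a quadratic form, so that its continuity follows from
    [quadratic_continuous]. *)
Lemma dotvvE (R : realType) d (x : 'rV[R]_d) :
  dotv x x = \sum_p \sum_q x 0 p * x 0 q * (q == p)%:R.
Proof.
apply: eq_bigr => p _; rewrite -[LHS](sum_delta (fun q => x 0 p * x 0 q)).
by apply: eq_bigr => q _; rewrite mulrC.
Qed.

Lemma sphere_compact (R : realType) d :
  compact [set x : 'rV[R]_d | enorm x = 1].
Proof.
rewrite (_ : [set x | _] = (fun x : 'rV[R]_d => dotv x x) @^-1` [set 1]).
  apply: bounded_closed_compact.
    (* Each squared coordinate is at most the sum of all of them, which is 1; this bounds the sup
       norm. *)
    exists 1; split=> [|M M1 x /= x1]; first exact: num_real.
    rewrite (le_trans _ (ltW M1))//= [leLHS]/Num.Def.normr/= mx_normrE.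
    apply/bigmax_leP; split=> //= -[k p] _ /=; rewrite (ord1 k).
    rewrite -(@ler_pXn2r _ 2)// ?nnegrE// expr1n -x1 real_normK ?num_real//.
    by rewrite /dotv (bigD1 p)//= lerDl sumr_ge0// => q _; exact: sqr_ge0.
  under eq_fun do rewrite dotvvE.
  apply: (continuous_closedP _).1; first exact: quadratic_continuous.
  exact: closed_eq.
by apply/seteqP; split=> x /=; rewrite enorm_eq1.
Qed.

Lemma quadratic_max_sphere (R : realType) d (A : 'I_d -> 'I_d -> R) :
  (0 < d)%N ->
  exists2 x : 'rV[R]_d, enorm x = 1 & forall y, enorm y = 1 ->
    \sum_p \sum_q y 0 p * y 0 q * A p q <= \sum_p \sum_q x 0 p * x 0 q * A p q.
Proof.
move=> d0; have sphere0 : [set x : 'rV[R]_d | enorm x = 1] !=set0.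
  exists (basis_vector R (Ordinal d0)) => /=; apply/enorm_eq1.
  rewrite -[RHS](sum_delta (fun=> 1) (Ordinal d0)); apply: eq_bigr => p _.
  by rewrite !mxE eqxx mulr1 -natrM mulnb andbb.
have [x] := EVT_max_rV sphere0 (@sphere_compact R d)
  (continuous_subspaceT (@quadratic_continuous R d A)).
rewrite inE => x1 xmax; exists x => // y y1; by apply: xmax; rewrite inE.
Qed.

(** * Positive-definiteness against the bound on the maximum *)

Theorem theorem5p1 (R : realType) (d : nat) (hd : d = 2%N \/ d = 3%N)
    (Omega : set 'rV[R]_d) (hOmega : polyhedral_lipschitz_domain Omega)
    (Np Ne : nat) (P : 'I_Np -> 'rV[R]_d) (T : 'I_Ne -> {set 'I_Np})
    (hT : triangulation Omega P T)
    (phi : 'I_Np -> 'rV[R]_d -> R) (hphi : nodal_basis Omega P T phi)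
    (lambda mu : R) (hmu : 0 < mu) (hlambda : 0 < lambda + 2 / d%:R * mu)
    (i j : 'I_Np)
    (hij : j \in neighbours Omega (isotropic lambda mu) phi i)
    (hGamma : ~ [set P i; P j] `<=` boundary Omega) :
  exists2 M : R,
    is_max [set \int[lebesgue_row R d]_(x in Omega)
                  (dotv (grad (phi j) x) xi * dotv (grad (phi i) x) xi)
           | xi in [set xi : 'rV[R]_d | enorm xi = 1]] M &
    (positive_definite
       (spring_constant Omega (isotropic lambda mu) phi i j) <->
     M < - mu / (lambda + mu) *
         \int[lebesgue_row R d]_(x in Omega)
           dotv (grad (phi j) x) (grad (phi i) x)).
Proof.
have [[_ oO _] [bO _ _]] := hOmega.
have iphi p q : (lebesgue_row R d).-integrable Omega
    (EFin \o (fun x => partial p (phi j) x * partial q (phi i) x)).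
  by apply: (P1_partialM_integrable oO bO hT); exact: hphi.1.
have mO := row_open_measurable oO.
(* As d >= 2, the factor 2/d is at most 1. *)
have lambda_mu : 0 < lambda + mu.
  apply: lt_le_trans hlambda _; rewrite lerD2l ler_piMl ?(ltW hmu)//.
  rewrite ler_pdivrMr ?mul1r ?ler_nat ?ltr0n; by case: hd => ->.
have d0 : (0 < d)%N by case: hd => ->.
set t := \int[_]_(x in _) dotv (grad _ _) (grad _ _).
pose q (xi : 'rV[R]_d) := \int[lebesgue_row R d]_(x in Omega)
  (dotv (grad (phi j) x) xi * dotv (grad (phi i) x) xi).
have formE xi : dotv (xi *m
    (spring_constant Omega (isotropic lambda mu) phi i j)^T) xi =
    - ((lambda + mu) * q xi + mu * t * dotv xi xi).
  exact: isotropic_spring_form.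
have qZ a xi : q (a *: xi) = a ^+ 2 * q xi.
  rewrite /q !Rintegral_gradM// mulr_sumr; apply: eq_bigr => p _.
  by rewrite mulr_sumr; apply: eq_bigr => r _; rewrite !mxE; ring.
have [xi xi1 ximax] := quadratic_max_sphere
  (fun p r => \int[lebesgue_row R d]_(x in Omega)
     (partial p (phi j) x * partial r (phi i) x)) d0.
have qmax eta : enorm eta = 1 -> q eta <= q xi.
  by rewrite /q !Rintegral_gradM//; exact: ximax.
exists (q xi); first by split=> [|_ [eta eta1 <-]]; [exists xi|exact: qmax].
(* Since lambda + mu > 0, the bound amounts to (lambda + mu) q(xi) + mu t < 0. *)
have -> : - mu / (lambda + mu) * t = - (mu * t) / (lambda + mu) by ring.
rewrite ltr_pdivlMr// mulrC ltrNr.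
(* Positivity at the maximiser [xi], a unit vector, is already the bound. *)
split=> [/(_ xi)|qxi eta eta0].
  rewrite formE (enorm_eq1 xi).1// mulr1.
  have xi0 : xi != 0.
    by rewrite -dotvv_eq0 (enorm_eq1 xi).1// oner_eq0.
  by move=> /(_ xi0); rewrite oppr_gt0 -ltrNr; lra.
(* Conversely, normalising [eta] and using homogeneity of degree 2 gives q(eta) <= c q(xi) with c =
   |eta|^2, so the form at [eta] is at least c times its positive value at [xi]. *)
have c0 : 0 < dotv eta eta by rewrite lt_neqAle eq_sym dotvv_eq0 eta0 dotvv_ge0.
set c := dotv eta eta in c0 *.
have s0 : 0 < Num.sqrt c by rewrite sqrtr_gt0.
have ss : Num.sqrt c ^+ 2 = c by rewrite sqr_sqrtr// ltW.
have etaE : eta = Num.sqrt c *: ((Num.sqrt c)^-1 *: eta).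
  by rewrite scalerA divff ?scale1r// gt_eqF.
have qeta : q eta <= c * q xi.
  rewrite [in leLHS]etaE qZ ss ler_pM2l//; apply: qmax; apply/enorm_eq1.
  by rewrite dotvZl dotvZr -/c -{3}ss; field; rewrite gt_eqF.
rewrite formE -/c oppr_gt0 {formE}.
move: (q eta) (q xi) t qeta qxi => q1 q2 t0 qeta qxi.
apply: le_lt_trans (_ : c * ((lambda + mu) * q2 + mu * t0) < 0).
  by rewrite mulrDr [c * (mu * t0)]mulrC lerD2r mulrCA ler_pM2l.
by rewrite pmulr_rlt0// -ltrBrDr sub0r -ltrNr.
Qed.
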